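(* Let $0\le k\le\mu$ be integers. For $f\in L^2(\mathbb{CP}^1,d\iota)$ with $R_\mu^*(f)\ge0$ (positive semidefinite) and every $z\in\mathbb{C}$, $$0\le E_{\mu,k}(f)(z)\le\mathrm{Tr}(R_\mu^*(f)).$$
   Context: $\mathcal{H}_\mu$ is the space of polynomials in one complex variable of degree $\le\mu$, with inner product $\langle f,g\rangle=\int_{\mathbb{C}}f\overline g\,d\iota_\mu$, $d\iota_\tau(z)=\frac{\tau+1}{(1+|z|^2)^\tau}\frac{dA(z)}{\pi(1+|z|^2)^2}$ ($dA$ Lebesgue measure); $d\iota:=d\iota_0$, the $SU(2)$-invariant probability measure on $\mathbb{CP}^1=\mathbb{C}\cup\{\infty\}$. For a function $f$, $R_\mu^*(f)$ is the operator on $\mathcal{H}_\mu$ given by $(R_\mu^*(f)h)(x)=\frac1{\mu+1}\int_{\mathbb{C}}f(z)h(z)(1+x\overline z)^\mu d\iota_\mu(z)$. The Berezin transform is $B_\tau(f)(z)=\int_{\mathbb{C}}\frac{|1+z\overline s|^{2\tau}}{(1+|z|^2)^\tau(1+|s|^2)^\tau}f(s)\,d\iota(s)$, and $E_{\mu,k}(f):=\binom{\mu}{k}\sum_{l=0}^k(-1)^{k-l}\binom{k}{l}B_{\mu-l}(f)$. *)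

(* Defs.v *)
(* MathComp-Analysis (Lebesgue integration) + real_closed complex numbers *)
From HB Require Import structures.
From mathcomp Require Import all_boot all_order all_algebra.
From mathcomp Require Import all_classical all_reals all_analysis.
From mathcomp Require Import complex.
Set Implicit Arguments. Unset Strict Implicit. Unset Printing Implicit Defensive.
Import Order.TTheory GRing.Theory Num.Theory.
Local Open Scope ring_scope.
Local Open Scope complex_scope.

Section Defs.
Variable R : realType.
Local Notation C := R[i].

(* identification R x R ~ C ; Lebesgue measure dA on C is the product measure *)
Definition cplx (p : R * R) : C := Complex p.1 p.2.
Definition leb2 := (@lebesgue_measure R \x @lebesgue_measure R)%E.

(* |z|^2 *)
Definition sqn (z : C) : R := complex.Re z ^+ 2 + complex.Im z ^+ 2.

(* density of d iota_tau w.r.t. dA :  (tau+1) / (pi (1+|z|^2)^(tau+2)) *)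
Definition iota_dens (tau : nat) (z : C) : R :=
  (tau.+1)%:R / (pi * (1 + sqn z) ^+ tau.+2).

(* integral over C of a complex-valued function against d iota_tau
   (real and imaginary parts integrated separately) *)
Definition Cint (tau : nat) (g : C -> C) : C :=
  Complex (Rintegral leb2 setT (fun p => complex.Re (g (cplx p)) * iota_dens tau (cplx p)))
          (Rintegral leb2 setT (fun p => complex.Im (g (cplx p)) * iota_dens tau (cplx p))).

(* f in L^2(CP^1, d iota)  (the point at infinity is a null set) *)
Definition L2_iota (f : C -> C) : Prop :=
  measurable_fun setT (fun p => complex.Re (f (cplx p))) /\
  measurable_fun setT (fun p => complex.Im (f (cplx p))) /\
  (\int[leb2]_p (sqn (f (cplx p)) * iota_dens 0 (cplx p))%:E < +oo)%E.

(* inner product of H_mu *)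
Definition inner_mu (mu : nat) (g h : C -> C) : C := Cint mu (fun z => g z * (h z)^*).

(* (R_mu^*(f) h)(x) = 1/(mu+1) int f(z) h(z) (1 + x conj z)^mu d iota_mu(z) *)
Definition Rstar (mu : nat) (f : C -> C) (h : {poly C}) (x : C) : C :=
  (mu.+1%:R)^-1 * Cint mu (fun z => f z * h.[z] * (1 + x * z^*) ^+ mu).

(* R_mu^*(f) >= 0 : positive semidefinite on H_mu *)
Definition Rstar_psd (mu : nat) (f : C -> C) : Prop :=
  forall h : {poly C}, (size h <= mu.+1)%N ->
    0 <= inner_mu mu (Rstar mu f h) (fun z => h.[z]).

(* trace computed in the orthonormal basis e_j = sqrt(binom mu j) z^j, j = 0..mu *)
Definition Rstar_trace (mu : nat) (f : C -> C) : C :=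
  \sum_(j < mu.+1) ('C(mu, j))%:R *
     inner_mu mu (Rstar mu f 'X^j) (fun z => z ^+ j).

(* Berezin transform B_tau(f)(z) *)
Definition Berezin (tau : nat) (f : C -> C) (z : C) : C :=
  Cint 0 (fun s => ((sqn (1 + z * s^*)) ^+ tau
                    / ((1 + sqn z) ^+ tau * (1 + sqn s) ^+ tau))%:C * f s).

(* E_{mu,k}(f) *)
Definition Emk (mu k : nat) (f : C -> C) (z : C) : C :=
  ('C(mu, k))%:R * \sum_(l < k.+1) ((-1) ^+ (k - l) * ('C(k, l))%:R * Berezin (mu - l) f z).

End Defs.

(* Main.v *)
(* Put [u s = |1 + z sbar|^2 / ((1+|z|^2)(1+|s|^2))], so that
   [1 - u s = |s - z|^2 / ((1+|z|^2)(1+|s|^2))]. By the binomial formula [E_{mu,k}(f)(z)] is the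
   integral of [C(mu,k) u^(mu-k) (1-u)^k f] against d iota, and
   [C(mu,k) u^(mu-k) (1-u)^k = c |h|^2 / (1+|s|^2)^mu] with [c >= 0] and the polynomial
   [h = (1 + zbar s)^(mu-k) (s - z)^k] of degree at most [mu]. Hence [E_{mu,k}(f)(z)] is
   [c <R*_mu(f) h, h> >= 0]. Summing over [k] gives the integral of [f] against d iota, which is
   the trace, so that each single term is at most the trace.
   The identity [<R*_mu(f) h, h> = 1/(mu+1) int f |h|^2 d iota_mu] amounts to the orthogonality
   relations of the monomials in [H_mu]. These follow without polar coordinates by integrating
   the derivatives of z^i zbar^j / (1+|z|^2)^n with respect to z and zbar over the plane, which
   yields recursions that end at the integral of (1+|z|^2)^-2. *)
Require Import Defs.
From HB Require Import structures.
From mathcomp Require Import all_boot all_order all_algebra.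
From mathcomp Require Import all_classical all_reals all_analysis.
From mathcomp Require Import measurable_realfun complex.
From mathcomp Require Import ring lra zify.
Set Implicit Arguments. Unset Strict Implicit. Unset Printing Implicit Defensive.
Import Order.TTheory GRing.Theory Num.Theory.
Import numFieldNormedType.Exports.
Local Open Scope classical_set_scope.
Local Open Scope ring_scope.
Local Open Scope complex_scope.
Local Notation "z ^*" := (Num.conj z) : complex_scope.

(** * Integrals over the real line by the fundamental theorem of calculus *)

Section line_integrals.
Variable R : realType.
Local Notation leb := (@lebesgue_measure R).

(** The line is cut at 0 and the negative half reflected by x -> -x, so that the half-line theorem
    applies twice. Nonnegativity replaces a prior proof of integrability. *)
Lemma ge0_FTC2T (f F : R -> R) (l m : R) :
  (forall x, 0 <= f x) -> continuous f ->
  (forall x : R, is_derive x (1 : R) F (f x)) ->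
  F x @[x --> +oo] --> l -> F (- x) @[x --> +oo] --> m ->
  (\int[leb]_x (f x)%:E = (l - m)%:E)%E.
Proof.
move=> f0 cf dF Fl Fm.
have cF : continuous F.
  move=> x; apply: differentiable_continuous; apply/derivable1_diffP.
  by have [] := dF x.
have mf : measurable_fun [set: R] f by exact: continuous_measurable_fun.
have mpos : measurable [set x : R | 0 <= x] by rewrite -set_itvcy.
rewrite -(setUv [set x : R | 0 <= x]) ge0_integral_setU//= ; last 4 first.
  exact: measurableC.
  by apply/measurable_EFinP; rewrite setUv.
  by move=> x _; rewrite lee_fin.
  exact/disj_setPCl.
rewrite -set_itvcy// setCitvr.
rewrite integral_itv_bndo_bndc; last exact/measurable_EFinP/measurable_funTS.
rewrite -{2}oppr0 ge0_integration_by_substitutionNy//; last first.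
  exact (continuous_subspaceT cf).
have dFN (x : R) : is_derive x (1 : R) (fun x => - F (- x)) (f (- x)).
  have dN : is_derive x (1 : R) -%R (- 1 : R) by exact: is_deriveNid.
  have h := is_deriveN (is_derive1_comp (dF (- x)) dN).
  by apply: (is_derive_eq h); rewrite /= mulrN1 opprK.
have -> : (\int[leb]_(x in `[0%R, +oo[) (f x)%:E = l%:E - (F 0)%:E)%E.
  apply: ge0_continuous_FTC2y Fl _ _ _ => //.
  - exact: (continuous_subspaceT cf).
  - by apply: cvg_at_right_filter; exact: cF.
  - by move=> x _; rewrite derive1E; have [_ ->] := dF x.
have -> : (\int[leb]_(x in `[0%R, +oo[) ((f \o -%R) x)%:E =
    (- m)%:E - (- F (- 0))%:E)%E.
  apply: (@ge0_continuous_FTC2y _ _ (fun x => - F (- x))) => //.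
  - by move=> x _ /=.
  - apply: continuous_subspaceT => x.
    by apply: continuous_comp; [exact: opp_continuous|exact: cf].
  - exact: cvgN.
  - apply: cvg_at_right_filter; apply: cvgN.
    by apply: continuous_comp; [exact: opp_continuous|exact: cF].
  - by move=> x _; rewrite derive1E; have [_ ->] := dFN x.
rewrite -!EFinB -EFinD oppr0; congr EFin; ring.
Qed.

Lemma cos_atan_sqr (x : R) : cos (atan x) ^+ 2 = (1 + x ^+ 2)^-1.
Proof. by rewrite cos_atan exprVn sqr_sqrtr// addr_ge0// sqr_ge0. Qed.

Lemma cos_atan_gt0 (x : R) : 0 < cos (atan x).
Proof. by apply: cos_gt0_pihalf; rewrite atan_gtNpi2 atan_ltpi2. Qed.

(** The function is cos(atan x)^2, whose limit is cos(pi/2)^2. *)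
Lemma cvgy_oneDsqrV : (1 + x ^+ 2)^-1 @[x --> +oo] --> (0 : R).
Proof.
rewrite [X in _ --> X](_ : _ = cos (pi / 2) ^+ 2); last by rewrite cos_pihalf expr0n.
under eq_cvg do rewrite -cos_atan_sqr.
apply: (cvg_comp _ (fun z : R => z ^+ 2)); last exact: exprn_continuous.
by apply: (cvg_comp (@atan R) (@cos R)); [exact: cvgy_atan|exact: continuous_cos].
Qed.

Lemma integralT_oneDsqr : (\int[leb]_x ((1 + x ^+ 2)^-1)%:E = (pi : R)%:E)%E.
Proof.
rewrite (@ge0_FTC2T _ atan (pi / 2) (- (pi / 2))).
- by congr EFin; field.
- by move=> x; rewrite invr_ge0 addr_ge0// sqr_ge0.
- exact: continuous_oneDsqrV.
- exact: cvgy_atan.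
- by under eq_cvg do rewrite atanN; apply: cvgN; exact: cvgy_atan.
Qed.

Lemma integrableT_oneDsqr : leb.-integrable setT (fun x => ((1 + x ^+ 2)^-1)%:E).
Proof.
apply/integrableP; split.
  apply/measurable_EFinP; apply: continuous_measurable_fun.
  exact: continuous_oneDsqrV.
under eq_integral => x _.
  rewrite gee0_abs; last by rewrite lee_fin invr_ge0 addr_ge0// sqr_ge0.
  over.
by rewrite integralT_oneDsqr ltry.
Qed.

(* Adding a multiple of [atan] to the primitive reduces to a nonnegative integrand. *)
Lemma FTC2T_decay (f F : R -> R) (A B : R) : continuous f ->
  (forall x : R, is_derive x (1 : R) F (f x)) ->
  (forall x, `|F x| <= A * (1 + x ^+ 2)^-1) ->
  (forall x, `|f x| <= B * (1 + x ^+ 2)^-1) ->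
  (\int[leb]_x (f x)%:E = 0)%E.
Proof.
move=> cf dF FA fB.
have h0 : A * (1 + x ^+ 2)^-1 @[x --> +oo] --> (0 : R).
  by rewrite -[X in _ --> X](mulr0 A); apply: cvgMl_tmp; exact: cvgy_oneDsqrV.
have F0 : F x @[x --> +oo] --> (0 : R).
  apply: (squeeze_cvgr _ _ h0); last first.
    by rewrite -[X in _ --> X]oppr0; exact: cvgN h0.
  by near=> x; rewrite -ler_norml.
have FN0 : F (- x) @[x --> +oo] --> (0 : R).
  apply: (squeeze_cvgr _ _ h0); last first.
    by rewrite -[X in _ --> X]oppr0; exact: cvgN h0.
  by near=> x; rewrite -ler_norml -[x ^+ 2]sqrrN.
pose g x := B * (1 + x ^+ 2)^-1.
have cg : continuous g.
  by move=> x; apply: cvgMl_tmp; exact: continuous_oneDsqrV.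
have ig : leb.-integrable setT (EFin \o g).
  have := integrableZl measurableT B integrableT_oneDsqr.
  by congr (_.-integrable _ _).
have iif : leb.-integrable setT (EFin \o f).
  apply: le_integrable ig => //.
    by apply/measurable_EFinP; exact: continuous_measurable_fun.
  move=> x _ /=; rewrite lee_fin (le_trans (fB x))//.
  exact: ler_norm.
have eg : (\int[leb]_x (g x)%:E = (B * pi)%:E)%E.
  rewrite EFinM -integralT_oneDsqr -integralZl//; last exact: integrableT_oneDsqr.
have efg : (\int[leb]_x (f x + g x)%:E = (0 + B * (pi / 2) - (0 - B * (pi / 2)))%:E)%E.
  apply: (@ge0_FTC2T _ (fun x => F x + B * atan x)).
  - by move=> x; move: (fB x); rewrite ler_norml => /andP[]; rewrite /g; lra.
  - by move=> x; apply: cvgD; [exact: cf|exact: cg].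
  - by apply: cvgD => //; apply: cvgMl_tmp; exact: cvgy_atan.
  - under eq_cvg do rewrite atanN mulrN.
    by apply: cvgB => //; apply: cvgMl_tmp; exact: cvgy_atan.
have := efg; under eq_integral do rewrite EFinD.
rewrite integralD// eg => /(congr1 (fun e => e - (B * pi)%:E)%E).
rewrite addeK// => ->; rewrite -EFinB; congr EFin; field.
Unshelve. all: by end_near. Qed.

End line_integrals.

(** * The integral of (1+|z|^2)^-2 over the plane *)

Section plane_mass.
Variable R : realType.
Local Notation leb := (@lebesgue_measure R).

(** The integrand is (1+x^2)^(-3/2), with primitive sin(atan x). It is the outer integral in the
    Tonelli computation of [integral_plane_decay2]. *)
Lemma integralT_cos_atan_cube : (\int[leb]_x (cos (atan x) ^+ 3)%:E = (2 : R)%:E)%E.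
Proof.
have d (x : R) : is_derive x (1 : R) (@sin R \o atan) (cos (atan x) ^+ 3).
  apply: (is_derive_eq (is_derive1_comp (is_derive_sin _) (is_derive1_atan x))).
  by rewrite -cos_atan_sqr exprS.
have c : continuous (fun x : R => cos (atan x)).
  by move=> x; apply: continuous_comp; [exact: continuous_atan|exact: continuous_cos].
have l : sin (atan x) @[x --> +oo] --> (1 : R).
  rewrite -(sin_pihalf R).
  by apply: (cvg_comp (@atan R) (@sin R)); [exact: cvgy_atan|exact: continuous_sin].
rewrite (@ge0_FTC2T _ _ (@sin R \o atan) 1 (- 1)) => //.
- by congr EFin; ring.
- by move=> x; rewrite exprn_ge0// ltW// cos_atan_gt0.
- move=> x; apply: (@continuous_comp _ _ _ (fun x : R => cos (atan x)) (fun z => z ^+ 3)).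
    exact: c.
  exact: exprn_continuous.
- under eq_cvg do rewrite /= atanN sinN.
  exact: cvgN.
Qed.

(** With k = (1+x^2)^(-1/2), the substitution k y = tan t turns the integrand into k^3 cos(t)^2 dt,
    whose primitive is k^3/2 (t + sin t cos t). *)
Lemma integral_inner_decay (x : R) :
  (\int[leb]_y ((1 + x ^+ 2 + y ^+ 2) ^- 2)%:E = (pi / 2 * cos (atan x) ^+ 3)%:E)%E.
Proof.
set k := cos (atan x).
have k0 : 0 < k by exact: cos_atan_gt0.
have kx : 1 + x ^+ 2 = k ^- 2 by rewrite -[LHS]invrK -cos_atan_sqr.
pose t (y : R) := atan (k * y).
pose F (y : R) := k ^+ 3 / 2 * (t y + sin (t y) * cos (t y)).
have dt (y : R) : is_derive y (1 : R) t (k * cos (t y) ^+ 2).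
  have dk : is_derive y (1 : R) (fun y : R => k * y) k.
    by apply: (is_derive_eq (is_deriveZ k (is_derive_id y (1 : R)))); rewrite [LHS]mulr1.
  apply: (is_derive_eq (is_derive1_comp (is_derive1_atan _) dk)).
  by rewrite cos_atan_sqr mulrC.
have dF (y : R) : is_derive y (1 : R) F ((1 + x ^+ 2 + y ^+ 2) ^- 2).
  have ds := is_derive1_comp (is_derive_sin (t y)) (dt y).
  have dc := is_derive1_comp (is_derive_cos (t y)) (dt y).
  have dsc := is_deriveM ds dc.
  apply: (is_derive_eq (is_deriveZ (k ^+ 3 / 2) (is_deriveD (dt y) dsc))).
  rewrite /= /GRing.scale /=.
  have := cos_atan_sqr (k * y); rewrite -/(t y) => ct.
  have := sin2cos2 (t y); set c := cos (t y) in ct *; set s := sin (t y) => sE.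
  transitivity (k ^+ 4 / 2 * c ^+ 2 * (1 + c ^+ 2 - s ^+ 2)); first by ring.
  rewrite sE ct kx.
  have ? : k != 0 by rewrite gt_eqF.
  have : 1 + (k * y) ^+ 2 != 0 by rewrite gt_eqF// ltr_wpDr// sqr_ge0.
  rewrite (_ : k ^- 2 + y ^+ 2 = (1 + (k * y) ^+ 2) / k ^+ 2); last by field.
  by move=> ?; field; apply/andP.
have lt : t y @[y --> +oo] --> (pi / 2 : R).
  apply: (cvg_comp (fun y => k * y) (@atan R)); last exact: cvgy_atan.
  by apply: gt0_cvgMry => //; exact: cvg_id.
have lF : F y @[y --> +oo] --> k ^+ 3 / 2 * (pi / 2).
  rewrite (_ : pi / 2 = pi / 2 + sin (pi / 2) * cos (pi / 2) :> R); last first.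
    by rewrite cos_pihalf mulr0 addr0.
  apply: cvgMl_tmp; apply: cvgD => //; apply: cvgM.
    exact: (cvg_comp _ _ lt (@continuous_sin R (pi / 2))).
  exact: (cvg_comp _ _ lt (@continuous_cos R (pi / 2))).
have pos (y : R) : 1 + x ^+ 2 + y ^+ 2 != 0.
  by rewrite gt_eqF// ltr_wpDr ?sqr_ge0// ltr_wpDr ?sqr_ge0.
rewrite (@ge0_FTC2T _ _ F (k ^+ 3 / 2 * (pi / 2)) (- (k ^+ 3 / 2 * (pi / 2)))) => //.
- by congr EFin; field.
- by move=> y; rewrite invr_ge0 exprn_even_ge0.
- move=> y; apply: cvgV; first by rewrite expf_neq0.
  apply: (@continuous_comp _ _ _ (fun y : R => 1 + x ^+ 2 + y ^+ 2) (fun z => z ^+ 2)).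
    by apply: cvgD; [exact: cvg_cst|exact: exprn_continuous].
  exact: exprn_continuous.
- suff -> : (fun y => F (- y)) = (fun y => - F y) by exact: cvgN.
  by apply/funext => y; rewrite /F /t mulrN atanN sinN cosN; ring.
Qed.

Lemma measurable_plane_decay :
  measurable_fun setT (fun p : R * R => (1 + (p.1 ^+ 2 + p.2 ^+ 2))^-1).
Proof.
(* As a function of the radius, it is a continuous function of one variable composed with a
   measurable one. *)
have -> : (fun p : R * R => (1 + (p.1 ^+ 2 + p.2 ^+ 2))^-1) =
    (fun t : R => (1 + t ^+ 2)^-1) \o (fun p => Num.sqrt (p.1 ^+ 2 + p.2 ^+ 2)).
  by apply/funext => p /=; rewrite sqr_sqrtr// addr_ge0// sqr_ge0.
apply: measurableT_comp.
  by apply: continuous_measurable_fun; exact: continuous_oneDsqrV.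
apply: measurableT_comp; first by apply: continuous_measurable_fun; exact: sqrt_continuous.
by apply: measurable_funD; apply: measurable_funX; [exact: measurable_fst|exact: measurable_snd].
Qed.

Lemma integral_plane_decay2 :
  (\int[@leb2 R]_p ((1 + (p.1 ^+ 2 + p.2 ^+ 2)) ^- 2)%:E = (pi : R)%:E)%E.
Proof.
rewrite /leb2 fubini_tonelli1//; last 2 first.
- apply/measurable_EFinP; under eq_fun do rewrite -exprVn.
  by apply: measurable_funX; exact: measurable_plane_decay.
- by move=> p; rewrite lee_fin invr_ge0 exprn_even_ge0.
under eq_integral => x _.
  rewrite /fubini_F; under eq_integral do rewrite addrA.
  rewrite integral_inner_decay EFinM; over.
rewrite integralZl//; last first.
  apply/integrableP; split.
    apply/measurable_EFinP; apply: measurable_funX; apply: continuous_measurable_fun => x.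
    by apply: continuous_comp; [exact: continuous_atan|exact: continuous_cos].
  under eq_integral => x _.
    rewrite gee0_abs; last by rewrite lee_fin exprn_ge0// ltW// cos_atan_gt0.
    over.
  by rewrite integralT_cos_atan_cube ltry.
by rewrite integralT_cos_atan_cube -EFinM mulfVK.
Qed.

Lemma integrable_plane_decay2 :
  (@leb2 R).-integrable setT (fun p => ((1 + (p.1 ^+ 2 + p.2 ^+ 2)) ^- 2)%:E).
Proof.
apply/integrableP; split.
  apply/measurable_EFinP; under eq_fun do rewrite -exprVn.
  by apply: measurable_funX; exact: measurable_plane_decay.
under eq_integral => p _.
  rewrite gee0_abs; last by rewrite lee_fin invr_ge0 exprn_even_ge0.
  over.
by rewrite integral_plane_decay2 ltry.
Qed.

End plane_mass.

(** * Integration of complex-valued functions over the plane *)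

Section complex_integral.
Variable R : realType.
Local Notation C := R[i].
Local Notation Re := complex.Re.
Local Notation Im := complex.Im.
Implicit Types (g h : R * R -> C) (c z : C).

Lemma ReM (x y : C) : Re (x * y) = Re x * Re y - Im x * Im y.
Proof. by case: x y => [a b] [c d]. Qed.
Lemma ImM (x y : C) : Im (x * y) = Re x * Im y + Im x * Re y.
Proof. by case: x y => [a b] [c d]. Qed.
Lemma ReD (x y : C) : Re (x + y) = Re x + Re y.
Proof. by case: x y => [a b] [c d]. Qed.
Lemma ImD (x y : C) : Im (x + y) = Im x + Im y.
Proof. by case: x y => [a b] [c d]. Qed.
Lemma ReJ (x : C) : Re x^* = Re x. Proof. by case: x. Qed.
Lemma ImJ (x : C) : Im x^* = - Im x. Proof. by case: x. Qed.

Lemma sqnM (x y : C) : sqn (x * y) = sqn x * sqn y.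
Proof. by rewrite /sqn ReM ImM; ring. Qed.

Lemma sqn1 : sqn (1 : C) = 1.
Proof. by rewrite /sqn /= expr1n expr0n addr0. Qed.

Lemma sqnX (x : C) n : sqn (x ^+ n) = sqn x ^+ n.
Proof. by elim: n => [|n IH]; rewrite ?expr0 ?sqn1// !exprS sqnM IH. Qed.

Lemma sqnJ (x : C) : sqn x^* = sqn x.
Proof. by rewrite /sqn ReJ ImJ sqrrN. Qed.

Lemma sqn_real (a : R) : sqn a%:C = a ^+ 2.
Proof. by rewrite /sqn /= expr0n addr0. Qed.

Lemma sqn_ge0 (x : C) : 0 <= sqn x.
Proof. by rewrite addr_ge0// sqr_ge0. Qed.

Lemma sqnE (x : C) : (sqn x)%:C = x * x^*.
Proof.
by case: x => a b; apply/eqP; rewrite eq_complex /sqn /=; apply/andP; split; apply/eqP; ring.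
Qed.

Definition Cmeasurable g :=
  measurable_fun setT (fun p => Re (g p)) /\ measurable_fun setT (fun p => Im (g p)).

Lemma Cmeasurable_cst c : Cmeasurable (fun=> c).
Proof. by split; exact: measurable_cst. Qed.

Lemma Cmeasurable_real (a : R * R -> R) :
  measurable_fun setT a -> Cmeasurable (fun p => (a p)%:C).
Proof. by move=> ma; split => //=; exact: measurable_cst. Qed.

Lemma Cmeasurable_cplx : Cmeasurable (@cplx R).
Proof. by split; [exact: measurable_fst|exact: measurable_snd]. Qed.

Lemma CmeasurableJ g : Cmeasurable g -> Cmeasurable (fun p => (g p)^*).
Proof.
move=> [m1 m2]; split; first by under eq_fun do rewrite ReJ.
by under eq_fun do rewrite ImJ; exact: measurableT_comp.
Qed.

Lemma CmeasurableD g h :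
  Cmeasurable g -> Cmeasurable h -> Cmeasurable (fun p => g p + h p).
Proof.
move=> [g1 g2] [h1 h2]; split.
  by under eq_fun do rewrite ReD; exact: measurable_funD.
by under eq_fun do rewrite ImD; exact: measurable_funD.
Qed.

Lemma CmeasurableM g h :
  Cmeasurable g -> Cmeasurable h -> Cmeasurable (fun p => g p * h p).
Proof.
move=> [g1 g2] [h1 h2]; split.
  by under eq_fun do rewrite ReM; apply: measurable_funB; exact: measurable_funM.
by under eq_fun do rewrite ImM; apply: measurable_funD; exact: measurable_funM.
Qed.

Lemma CmeasurableX g n : Cmeasurable g -> Cmeasurable (fun p => g p ^+ n).
Proof.
move=> mg; elim: n => [|n IH]; first by under eq_fun do rewrite expr0; exact: Cmeasurable_cst.
by under eq_fun do rewrite exprS; exact: CmeasurableM.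
Qed.

Definition Cintegrable g :=
  (@leb2 R).-integrable setT (fun p => (Re (g p))%:E) /\
  (@leb2 R).-integrable setT (fun p => (Im (g p))%:E).

(** Unlike [Cint], this has no density built in, so linearity is proved once for all exponents;
    [CintE] links the two. *)
Definition Cintegral g : C :=
  Complex (Rintegral (@leb2 R) setT (fun p => Re (g p)))
          (Rintegral (@leb2 R) setT (fun p => Im (g p))).

(** Comparing squares keeps square roots and the sign of [w] out of the hypothesis; it bounds |Re g|
    and |Im g| by |w|. *)
Lemma le_Cintegrable g (w : R * R -> R) : Cmeasurable g ->
  (@leb2 R).-integrable setT (fun p => (w p)%:E) ->
  (forall p, sqn (g p) <= w p ^+ 2) -> Cintegrable g.
Proof.
move=> [m1 m2] iw gw; split; apply: le_integrable iw => //.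
- exact/measurable_EFinP.
- move=> p _ /=; rewrite lee_fin -ler_sqr ?nnegrE// !real_normK ?num_real//.
  by apply: le_trans (gw p); rewrite lerDl sqr_ge0.
- exact/measurable_EFinP.
- move=> p _ /=; rewrite lee_fin -ler_sqr ?nnegrE// !real_normK ?num_real//.
  by apply: le_trans (gw p); rewrite lerDr sqr_ge0.
Qed.

Lemma CintegrableD g h :
  Cintegrable g -> Cintegrable h -> Cintegrable (fun p => g p + h p).
Proof.
move=> [g1 g2] [h1 h2]; split.
  under eq_fun do rewrite ReD EFinD.
  exact: (integrableD _ g1 h1).
under eq_fun do rewrite ImD EFinD.
exact: (integrableD _ g2 h2).
Qed.

Lemma CintegralD g h : Cintegrable g -> Cintegrable h ->
  Cintegral (fun p => g p + h p) = Cintegral g + Cintegral h.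
Proof.
move=> [g1 g2] [h1 h2]; rewrite /Cintegral.
under eq_Rintegral do rewrite ReD.
under [X in Complex _ X]eq_Rintegral do rewrite ImD.
by rewrite RintegralD// RintegralD.
Qed.

Lemma CintegrableZ c g : Cintegrable g -> Cintegrable (fun p => c * g p).
Proof.
move=> [g1 g2]; split.
  under eq_fun do rewrite ReM EFinB !EFinM.
  by apply: integrableB => //; exact: integrableZl.
under eq_fun do rewrite ImM EFinD !EFinM.
by apply: integrableD => //; exact: integrableZl.
Qed.

Lemma CintegralZ c g : Cintegrable g ->
  Cintegral (fun p => c * g p) = c * Cintegral g.
Proof.
move=> [g1 g2]; have iZ (a : R) (u : R * R -> R) :
    (@leb2 R).-integrable setT (fun p => (u p)%:E) ->
    (@leb2 R).-integrable setT (EFin \o (fun p => a * u p)).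
  by move=> iu; exact: (integrableZl measurableT a iu).
rewrite /Cintegral.
under eq_Rintegral do rewrite ReM.
under [X in Complex _ X]eq_Rintegral do rewrite ImM.
rewrite RintegralB//; [|exact: iZ|exact: iZ].
rewrite RintegralD//; [|exact: iZ|exact: iZ].
by rewrite !RintegralZl//; case: c.
Qed.

Lemma Cintegral0 : Cintegral (fun=> 0) = 0.
Proof. by rewrite /Cintegral /Rintegral integral0. Qed.

Lemma Cintegrable0 : Cintegrable (fun=> 0).
Proof. by split; exact: integrable0. Qed.

Lemma Cintegrable_sum (I : Type) (r : seq I) (G : I -> R * R -> C) :
  (forall i, Cintegrable (G i)) -> Cintegrable (fun p => \sum_(i <- r) G i p).
Proof.
move=> iG; elim: r => [|i r IH].
  by under eq_fun do rewrite big_nil; exact: Cintegrable0.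
by under eq_fun do rewrite big_cons; exact: CintegrableD.
Qed.

Lemma Cintegral_sum (I : Type) (r : seq I) (G : I -> R * R -> C) :
  (forall i, Cintegrable (G i)) ->
  Cintegral (fun p => \sum_(i <- r) G i p) = \sum_(i <- r) Cintegral (G i).
Proof.
move=> iG; elim: r => [|i r IH].
  by under eq_fun do rewrite big_nil; rewrite big_nil Cintegral0.
under eq_fun do rewrite big_cons.
by rewrite CintegralD ?IH ?big_cons//; exact: Cintegrable_sum.
Qed.

End complex_integral.

(** * The functions z^i zbar^j / (1+|z|^2)^n and their derivatives along lines *)

Section moments.
Variable R : realType.
Local Notation C := R[i].
Local Notation Re := complex.Re.
Local Notation Im := complex.Im.
Implicit Types (p : R * R) (i j n m : nat) (e : C).

(** Differentiation in a real parameter is done componentwise, so that conjugation, which is not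
    holomorphic, is covered. *)
Definition Cderive (phi psi : R -> C) := forall t : R,
  is_derive t (1 : R) (fun t => Re (phi t)) (Re (psi t)) /\
  is_derive t (1 : R) (fun t => Im (phi t)) (Im (psi t)).

Lemma CderiveM (f f' g g' : R -> C) : Cderive f f' -> Cderive g g' ->
  Cderive (fun t => f t * g t) (fun t => f t * g' t + f' t * g t).
Proof.
move=> df dg t; have [f1 f2] := df t; have [g1 g2] := dg t; split.
  under eq_fun do rewrite ReM.
  apply: (is_derive_eq (is_deriveB (is_deriveM f1 g1) (is_deriveM f2 g2))).
  by rewrite /GRing.scale /= ReD !ReM; ring.
under eq_fun do rewrite ImM.
apply: (is_derive_eq (is_deriveD (is_deriveM f1 g2) (is_deriveM f2 g1))).
by rewrite /GRing.scale /= ImD !ImM; ring.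
Qed.

Lemma Cderive_eq (f f' g : R -> C) : Cderive f f' -> f' =1 g -> Cderive f g.
Proof. by move=> df /funext <-. Qed.

Lemma Cderive_cst (c : C) : Cderive (fun=> c) (fun=> 0).
Proof. by move=> t; split; exact: is_derive_cst. Qed.

Lemma CderiveX (f f' : R -> C) n : Cderive f f' ->
  Cderive (fun t => f t ^+ n) (fun t => n%:R * f t ^+ n.-1 * f' t).
Proof.
move=> df; elim: n => [|n IH].
  by apply: (Cderive_eq (Cderive_cst 1)) => t; rewrite !mul0r.
under [X in Cderive X]eq_fun do rewrite exprS.
apply: (Cderive_eq (CderiveM df IH)) => t /=.
(* At exponent 0 the truncated [n.-1] is no true predecessor, but its term has coefficient 0. *)
case: n IH => [|n] IH; first by rewrite !expr0; ring.
by rewrite -[n.+2%:R]natr1 /= exprS; ring.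
Qed.

Lemma CderiveJ (f f' : R -> C) :
  Cderive f f' -> Cderive (fun t => (f t)^*) (fun t => (f' t)^*).
Proof.
move=> df t; have [f1 f2] := df t; split; first by under eq_fun do rewrite ReJ; rewrite ReJ.
by under eq_fun do rewrite ImJ; rewrite ImJ; exact: is_deriveN.
Qed.

Lemma Cderive_real (a a' : R -> R) : (forall t : R, is_derive t (1 : R) a (a' t)) ->
  Cderive (fun t => (a t)%:C) (fun t => (a' t)%:C).
Proof. by move=> da t; split => //=; exact: is_derive_cst. Qed.

Lemma Cderive_continuous (f f' : R -> C) : Cderive f f' ->
  continuous (fun t => Re (f t)) /\ continuous (fun t => Im (f t)).
Proof.
move=> df; split=> t; apply: differentiable_continuous; apply/derivable1_diffP.
  by have [[]] := df t.
by have [_ []] := df t.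
Qed.

(* [gdec] is 1/(1+|z|^2) and [mono i j n] is z^i zbar^j / (1+|z|^2)^n. *)
Definition gdec p : R := (1 + sqn (cplx p))^-1.

Definition mono i j n p : C := cplx p ^+ i * (cplx p)^* ^+ j * (gdec p ^+ n)%:C.

Lemma one_sqn_gt0 (z : C) : 0 < 1 + sqn z.
Proof. by rewrite ltr_wpDr// sqn_ge0. Qed.

Lemma gdec_gt0 p : 0 < gdec p.
Proof. by rewrite invr_gt0 one_sqn_gt0. Qed.

Lemma sqn_mono i j n p : sqn (mono i j n p) = sqn (cplx p) ^+ (i + j) * gdec p ^+ n ^+ 2.
Proof. by rewrite !sqnM !sqnX sqnJ sqn_real exprD. Qed.

(** |z|^2 <= 1+|z|^2 lets the numerator cancel at most 2n-2m of the 2n factors [gdec]. The cases m =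
    0, 1, 2 give boundedness, decay along lines and integrability over the plane. *)
Lemma mono_le i j n m p : (i + j + m.*2 <= n.*2)%N ->
  sqn (mono i j n p) <= gdec p ^+ m ^+ 2.
Proof.
move=> h; rewrite sqn_mono -!exprM !muln2.
have s1 : 1 <= 1 + sqn (cplx p) by rewrite lerDl sqn_ge0.
have /le_trans -> // : sqn (cplx p) ^+ (i + j) * gdec p ^+ n.*2 <=
    (1 + sqn (cplx p)) ^+ (n.*2 - m.*2) * gdec p ^+ n.*2.
  apply: ler_wpM2r; first by rewrite exprn_ge0// ltW// gdec_gt0.
  apply: (@le_trans _ _ ((1 + sqn (cplx p)) ^+ (i + j))).
    by rewrite lerXn2r ?nnegrE ?sqn_ge0 ?(ltW (one_sqn_gt0 _))// lerDr.
  by apply: ler_weXn2l => //; rewrite leq_subRL ?(leq_trans _ h) ?leq_addl// addnC.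
have mn : (m.*2 <= n.*2)%N by rewrite (leq_trans _ h)// leq_addl.
by rewrite -{2}(subnK mn) exprD mulrA -exprMn mulfV ?gt_eqF ?one_sqn_gt0// expr1n mul1r.
Qed.

Lemma measurable_gdec : measurable_fun setT gdec.
Proof. exact: measurable_plane_decay. Qed.

Lemma Cmeasurable_mono i j n : Cmeasurable (mono i j n).
Proof.
apply: CmeasurableM; last first.
  by apply: Cmeasurable_real; apply: measurable_funX; exact: measurable_gdec.
by apply: CmeasurableM; apply: CmeasurableX; [|apply: CmeasurableJ];
  exact: Cmeasurable_cplx.
Qed.

Lemma integrable_gdec2 : (@leb2 R).-integrable setT (fun p => (gdec p ^+ 2)%:E).
Proof. by under eq_fun do rewrite exprVn; exact: integrable_plane_decay2. Qed.

Lemma Cintegrable_mono i j n : (i + j + 4 <= n.*2)%N -> Cintegrable (mono i j n).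
Proof.
move=> h; apply: (le_Cintegrable (Cmeasurable_mono i j n) integrable_gdec2) => p.
exact: mono_le.
Qed.

Definition moment i j n : C := Cintegral (mono i j n).

(** Along a line of direction e, the derivative is e d/dz + e^* d/dzbar. Differentiating the
    denominator raises n by one and multiplies by zbar or z. *)
Lemma Cderive_mono (gam : R -> R * R) e i j n :
  Cderive (fun t => cplx (gam t)) (fun=> e) ->
  Cderive (fun t => mono i j n (gam t)) (fun t =>
    e * (i%:R * mono i.-1 j n (gam t)) + e^* * (j%:R * mono i j.-1 n (gam t))
    + (- (n%:R * e)) * mono i j.+1 n.+1 (gam t)
    + (- (n%:R * e^*)) * mono i.+1 j n.+1 (gam t)).
Proof.
move=> dg.
(* The derivative of |z|^2 along the line, equal to e zbar + e^* z. *)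
pose s' t : R := 2 * (Re (cplx (gam t)) * Re e + Im (cplx (gam t)) * Im e).
have dG (t : R) : is_derive t (1 : R) (fun t => gdec (gam t) ^+ n)
    (- (n%:R * gdec (gam t) ^+ n.+1 * s' t)).
  have [d1 d2] := dg t.
  have ds : is_derive t (1 : R) (fun t => 1 + sqn (cplx (gam t))) (s' t).
    apply: (is_derive_eq (is_deriveD (is_derive_cst (1 : R) t (1 : R))
      (is_deriveD (is_deriveX 2 d1) (is_deriveX 2 d2)))).
    by rewrite /GRing.scale /= /s' !expr1; ring.
  have nz : 1 + sqn (cplx (gam t)) != 0 by rewrite gt_eqF// one_sqn_gt0.
  have dX := is_deriveX n 
    (@is_deriveV R (fun t => 1 + sqn (cplx (gam t))) t _ _ nz ds).
  rewrite exprfctE in dX.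
  apply: (is_derive_eq dX).
  rewrite /GRing.scale /= -exprVn -/(gdec _).
  by case: n {dX} => [|n]; [ring|rewrite /= !exprS; ring].
have dG' := Cderive_real dG.
have d := CderiveM (CderiveM (CderiveX i dg) (CderiveX j (CderiveJ dg))) dG'.
apply: (Cderive_eq d) => t; rewrite /mono.
have s'E : (s' t)%:C = e * (cplx (gam t))^* + e^* * cplx (gam t).
  rewrite /s'; case: e {dg dG dG' d s'} => a b; apply/eqP; rewrite eq_complex /=.
  by apply/andP; split; apply/eqP; ring.
move: (s' t) s'E => S SE.
rewrite rmorphN !rmorphM /= SE rmorph_nat !rmorphXn /=.
rewrite ![_ ^+ j.+1]exprS ![_ ^+ i.+1]exprS.
ring.
Qed.

(** On horizontal and vertical lines [gdec] is at most 1/(1+t^2), the rate that [FTC2T_decay] asks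
    of both primitive and derivative. *)
Definition decays (g : R * R -> C) := exists K : R, forall p,
  `|Re (g p)| <= K * gdec p /\ `|Im (g p)| <= K * gdec p.

Lemma decaysD g h : decays g -> decays h -> decays (fun p => g p + h p).
Proof.
move=> [K gK] [L hL]; exists (K + L) => p; rewrite ReD ImD mulrDl.
have [g1 g2] := gK p; have [h1 h2] := hL p.
by split; apply: le_trans (ler_normD _ _) _; apply: lerD.
Qed.

Lemma decaysZ c g : decays g -> decays (fun p => c * g p).
Proof.
move=> [K gK]; exists ((`|Re c| + `|Im c|) * K) => p; rewrite ReM ImM -mulrA.
have [g1 g2] := gK p.
split; [apply: le_trans (ler_normB _ _) _|apply: le_trans (ler_normD _ _) _];
  by rewrite !normrM mulrDl; apply: lerD; rewrite ler_wpM2l.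
Qed.

Lemma decays_mono i j n : (i + j + 2 <= n.*2)%N -> decays (mono i j n).
Proof.
move=> h; exists 1 => p; rewrite mul1r.
have le1 := @mono_le i j n 1 p h; rewrite expr1 in le1.
have g0 := ltW (gdec_gt0 p).
by split; rewrite -ler_sqr ?nnegrE// real_normK ?num_real//; apply: le_trans le1;
  rewrite ?lerDl ?lerDr sqr_ge0.
Qed.

Definition Ccontinuous (f : R -> C) :=
  continuous (fun t => Re (f t)) /\ continuous (fun t => Im (f t)).

Lemma CcontinuousD (f g : R -> C) :
  Ccontinuous f -> Ccontinuous g -> Ccontinuous (fun t => f t + g t).
Proof.
move=> [f1 f2] [g1 g2]; split.
  by under eq_fun do rewrite ReD; move=> t; apply: cvgD; [exact: f1|exact: g1].
by under eq_fun do rewrite ImD; move=> t; apply: cvgD; [exact: f2|exact: g2].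
Qed.

Lemma CcontinuousZ (c : C) (f : R -> C) :
  Ccontinuous f -> Ccontinuous (fun t => c * f t).
Proof.
move=> [f1 f2]; split.
  under eq_fun do rewrite ReM.
  by move=> t; apply: cvgB; apply: cvgMl_tmp; [exact: f1|exact: f2].
under eq_fun do rewrite ImM.
by move=> t; apply: cvgD; apply: cvgMl_tmp; [exact: f2|exact: f1].
Qed.

(* The derivative of [mono i j n] in the direction [e]. *)
Definition dmono e i j n p : C :=
  e * (i%:R * mono i.-1 j n p) + e^* * (j%:R * mono i j.-1 n p)
  + (- (n%:R * e)) * mono i j.+1 n.+1 p + (- (n%:R * e^*)) * mono i.+1 j n.+1 p.

Lemma integral_dmono_line (gam : R -> R * R) e i j n :
  Cderive (fun t => cplx (gam t)) (fun=> e) ->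
  (forall t, gdec (gam t) <= (1 + t ^+ 2)^-1) ->
  (i + j + 2 <= n.*2)%N ->
  (\int[@lebesgue_measure R]_t (Re (dmono e i j n (gam t)))%:E = 0)%E /\
  (\int[@lebesgue_measure R]_t (Im (dmono e i j n (gam t)))%:E = 0)%E.
Proof.
move=> dg gle h.
have d := Cderive_mono i j n dg.
have cm a b m : Ccontinuous (fun t => mono a b m (gam t)).
  exact: Cderive_continuous (Cderive_mono a b m dg).
have [c1 c2] : Ccontinuous (fun t => dmono e i j n (gam t)).
  apply: CcontinuousD; last exact: CcontinuousZ.
  apply: CcontinuousD; last exact: CcontinuousZ.
  by apply: CcontinuousD; do 2 apply: CcontinuousZ.
have [A FA] := decays_mono h.
have [B fB] : decays (dmono e i j n).
  apply: decaysD; last by apply: decaysZ; apply: decays_mono; lia.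
  apply: decaysD; last by apply: decaysZ; apply: decays_mono; lia.
  by apply: decaysD; do 2 apply: decaysZ; apply: decays_mono; lia.
(* Enlarging v needs K >= 0, which is forced by 0 <= |u| <= K v with v > 0. *)
have pos (K u v : R) (t : R) : `|u| <= K * v -> 0 < v -> v <= (1 + t ^+ 2)^-1 ->
    `|u| <= K * (1 + t ^+ 2)^-1.
  move=> uK v0 vt; apply: (le_trans uK); apply: ler_wpM2l => //.
  by rewrite -(pmulr_lge0 _ v0) (le_trans _ uK).
split.
- apply: (@FTC2T_decay _ _ (fun t => Re (mono i j n (gam t))) A B) => //.
  + by move=> t; have [] := d t.
  + by move=> t; have [] := FA (gam t) => FA1 _; apply: pos FA1 (gdec_gt0 _) (gle _).
  + by move=> t; have [] := fB (gam t) => FA1 _; apply: pos FA1 (gdec_gt0 _) (gle _).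
- apply: (@FTC2T_decay _ _ (fun t => Im (mono i j n (gam t))) A B) => //.
  + by move=> t; have [] := d t.
  + by move=> t; have [] := FA (gam t) => _ FA1; apply: pos FA1 (gdec_gt0 _) (gle _).
  + by move=> t; have [] := fB (gam t) => _ FA1; apply: pos FA1 (gdec_gt0 _) (gle _).
Qed.

End moments.

(** * Recursion for the moments and orthogonality of the monomials *)

Section moment_values.
Variable R : realType.
Local Notation C := R[i].
Local Notation Re := complex.Re.
Local Notation Im := complex.Im.
Implicit Types (p : R * R) (i j n m : nat) (e : C).

(** The coefficient stands for an exponent brought down by differentiation. When it is 0, truncation
    leaves the exponent unlowered and the degree bound may fail, so the bound is asked only for
    nonzero a. *)
Lemma Cintegrable_natmono a i j n : (a != 0%N -> (i + j + 4 <= n.*2)%N) ->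
  Cintegrable (fun p => a%:R * mono i j n p : C).
Proof.
case: a => [_|a h]; last by apply: CintegrableZ; exact: (Cintegrable_mono _ (h isT)).
by under eq_fun do rewrite mul0r; exact: Cintegrable0.
Qed.

Lemma Cintegral_natmono a i j n : (a != 0%N -> (i + j + 4 <= n.*2)%N) ->
  Cintegral (fun p => a%:R * mono i j n p : C) = a%:R * moment R i j n.
Proof.
case: a => [_|a h]; last by rewrite CintegralZ//; exact: (Cintegrable_mono _ (h isT)).
by under eq_fun do rewrite mul0r; rewrite Cintegral0 mul0r.
Qed.

Lemma Cintegrable_dmono e i j n : (i + j + 3 <= n.*2)%N -> Cintegrable (dmono e i j n).
Proof.
move=> h.
apply: CintegrableD; last by apply: CintegrableZ; apply: Cintegrable_mono; lia.
apply: CintegrableD; last by apply: CintegrableZ; apply: Cintegrable_mono; lia.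
by apply: CintegrableD; apply: CintegrableZ; apply: Cintegrable_natmono; lia.
Qed.

(** The factors of e and e^* are the integrals of the derivatives in z and zbar. *)
Lemma Cintegral_dmono e i j n : (i + j + 3 <= n.*2)%N ->
  Cintegral (dmono e i j n) =
    e * (i%:R * moment R i.-1 j n - n%:R * moment R i j.+1 n.+1)
    + e^* * (j%:R * moment R i j.-1 n - n%:R * moment R i.+1 j n.+1).
Proof.
move=> h.
have n1 : Cintegrable (fun p => i%:R * mono i.-1 j n p : C).
  by apply: Cintegrable_natmono; lia.
have n2 : Cintegrable (fun p => j%:R * mono i j.-1 n p : C).
  by apply: Cintegrable_natmono; lia.
have i1 := CintegrableZ e n1.
have i2 := CintegrableZ e^* n2.
have i3 : Cintegrable (@mono R i j.+1 n.+1) by apply: Cintegrable_mono; lia.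
have i4 : Cintegrable (@mono R i.+1 j n.+1) by apply: Cintegrable_mono; lia.
have i12 := CintegrableD i1 i2.
have i3' := CintegrableZ (- (n%:R * e)) i3.
have i4' := CintegrableZ (- (n%:R * e^*)) i4.
have i123 := CintegrableD i12 i3'.
rewrite /dmono (CintegralD i123 i4') (CintegralD i12 i3') (CintegralD i1 i2).
rewrite (CintegralZ _ i3) (CintegralZ _ i4) (CintegralZ _ n1) (CintegralZ _ n2).
rewrite !Cintegral_natmono; [|lia|lia].
rewrite -/(moment R i j.+1 n.+1) -/(moment R i.+1 j n.+1); ring.
Qed.

Lemma gdec_lel p : gdec p <= (1 + p.1 ^+ 2)^-1.
Proof.
rewrite lef_pV2 ?posrE ?one_sqn_gt0//; last by rewrite ltr_wpDr ?sqr_ge0.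
by rewrite lerD2l lerDl sqr_ge0.
Qed.

Lemma gdec_ler p : gdec p <= (1 + p.2 ^+ 2)^-1.
Proof.
rewrite lef_pV2 ?posrE ?one_sqn_gt0//; last by rewrite ltr_wpDr ?sqr_ge0.
by rewrite lerD2l lerDr sqr_ge0.
Qed.

(** By Fubini, it is enough to integrate first along horizontal lines, where [integral_dmono_line]
    gives 0. Vertical lines serve in the same way for direction i. *)
Lemma Cintegral_dmono1_eq0 i j n : (i + j + 3 <= n.*2)%N ->
  Cintegral (@dmono R 1 i j n) = 0.
Proof.
move=> h; have [i1 i2] := Cintegrable_dmono 1 h.
have l (y : R) := @integral_dmono_line R (fun t => (t, y)) 1 i j n.
have d (y : R) : Cderive (fun t => cplx (t, y)) (fun=> 1).
  by move=> t; split; [exact: is_derive_id|exact: is_derive_cst].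
have h' : (i + j + 2 <= n.*2)%N by lia.
rewrite /Cintegral /Rintegral -(integral21_prod_meas1 i1) -(integral21_prod_meas1 i2).
rewrite /fubini_G !integral0_eq//= => y _.
  by have [] := l y (d y) (fun t => gdec_lel (t, y)) h'.
by have [] := l y (d y) (fun t => gdec_lel (t, y)) h'.
Qed.

Lemma Cintegral_dmonoi_eq0 i j n : (i + j + 3 <= n.*2)%N ->
  Cintegral (@dmono R 'i i j n) = 0.
Proof.
move=> h; have [i1 i2] := Cintegrable_dmono 'i h.
have l (x : R) := @integral_dmono_line R (fun t => (x, t)) 'i i j n.
have d (x : R) : Cderive (fun t => cplx (x, t)) (fun=> 'i).
  by move=> t; split; [exact: is_derive_cst|exact: is_derive_id].
have h' : (i + j + 2 <= n.*2)%N by lia.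
rewrite /Cintegral /Rintegral -(integral12_prod_meas1 i1) -(integral12_prod_meas1 i2).
rewrite /fubini_F !integral0_eq//= => x _.
  by have [] := l x (d x) (fun t => gdec_ler (x, t)) h'.
by have [] := l x (d x) (fun t => gdec_ler (x, t)) h'.
Qed.

(* The integrals of d/dx and d/dy vanish, hence so do those of d/dz and d/dzbar. *)
Lemma moment_rec i j n : (i + j + 3 <= n.*2)%N ->
  i%:R * moment R i.-1 j n = n%:R * moment R i j.+1 n.+1 /\
  j%:R * moment R i j.-1 n = n%:R * moment R i.+1 j n.+1.
Proof.
move=> h; have := Cintegral_dmono1_eq0 h; have := Cintegral_dmonoi_eq0 h.
rewrite !Cintegral_dmono//; set a := _ - _; set b := _ - _.
have -> : ('i : C)^* = - 'i by apply/eqP; rewrite eq_complex /= oppr0 !eqxx.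
rewrite rmorph1 mulNr !mul1r -mulrBr => /eqP; rewrite mulf_eq0 => /orP[|/eqP].
  by rewrite eq_complex /= oner_eq0 andbF.
move=> /eqP; rewrite subr_eq0 => /eqP ab; rewrite ab -mulr2n => /eqP.
rewrite mulrn_eq0 /= => /eqP b0; move: ab; rewrite b0 => /eqP; rewrite subr_eq0 => /eqP ->.
by split=> //; move/eqP: b0; rewrite subr_eq0 => /eqP.
Qed.

Lemma moment002 : moment R 0 0 2 = (pi)%:C.
Proof.
have -> : moment R 0 0 2 =
    Cintegral (fun p => ((1 + (p.1 ^+ 2 + p.2 ^+ 2)) ^- 2)%:C).
  congr Cintegral; apply/funext => p.
  by rewrite /mono !expr0 !mul1r /gdec exprVn.
by rewrite /Cintegral /Rintegral /= integral_plane_decay2 integral0.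
Qed.

(** Write M(n) for the moment with i = j = 0. Since |z|^2/(1+|z|^2)^(m+3) is the difference of
    consecutive powers, the recursion at (0,1) reads M(m+2) = (m+2) (M(m+2) - M(m+3)), so (m+2)
    M(m+3) = (m+1) M(m+2). *)
Lemma moment_nat0 m : m.+1%:R * moment R 0 0 m.+2 = (pi)%:C.
Proof.
elim: m => [|m IH]; first by rewrite mul1r moment002.
rewrite -IH.
have [_] := @moment_rec 0 1 m.+2 isT; rewrite mul1r => h.
have i2 : Cintegrable (@mono R 0 0 m.+3) by apply: Cintegrable_mono; lia.
have i3 : Cintegrable (@mono R 1 1 m.+3) by apply: Cintegrable_mono; lia.
have -> : moment R 0 0 m.+3 = moment R 0 0 m.+2 - moment R 1 1 m.+3.
  apply/eqP; rewrite eq_sym subr_eq; apply/eqP.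
  rewrite /moment -(CintegralD i2 i3); congr Cintegral; apply/funext => p.
  rewrite /mono !expr0 !expr1 !mul1r -sqnE -rmorphM -rmorphD; congr (_%:C).
  rewrite [gdec p ^+ m.+3]exprS -[X in _ = X + _]mul1r -mulrDl mulrA.
  by rewrite mulfV ?mul1r// gt_eqF// one_sqn_gt0.
rewrite mulrBr -h -[m.+2%:R]natr1; ring.
Qed.

(** The recursion lowers i, j and mu together. If exactly one exponent reaches 0, the recursion has
    a zero coefficient and the moment vanishes; on the diagonal, (mu+1) C(mu,j) = (j+1) C(mu+1,j+1)
    carries the induction. *)
Lemma momentE mu i j : (i <= mu)%N -> (j <= mu)%N ->
  mu.+1%:R * moment R i j mu.+2 =
  (pi)%:C * (if i == j then ('C(mu, i)%:R)^-1 else 0).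
Proof.
elim: mu i j => [|mu IH] [|i] [|j] // hi hj.
- by rewrite eqxx bin0 invr1 mulr1; exact: moment_nat0.
- by rewrite eqxx bin0 invr1 mulr1; exact: moment_nat0.
- have [h _] := @moment_rec 0 j mu.+2 ltac:(lia).
  by move: h; rewrite mul0r mulr0 => <-.
- have [_ h] := @moment_rec i 0 mu.+2 ltac:(lia).
  by move: h; rewrite mul0r mulr0 => <-.
have [_ h] := @moment_rec i j.+1 mu.+2 ltac:(lia).
rewrite -h /= eqSS; have := IH i j hi hj.
have nz : (mu.+1%:R : C) != 0 by rewrite pnatr_eq0.
case: eqP => [->|_] E; last first.
  move: E; rewrite !mulr0 => /eqP; rewrite mulf_eq0 (negbTE nz) /= => /eqP ->.
  by rewrite mulr0.
have b1 : ('C(mu, j)%:R : C) != 0 by rewrite pnatr_eq0 -lt0n bin_gt0.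
have b2 : ('C(mu.+1, j.+1)%:R : C) != 0 by rewrite pnatr_eq0 -lt0n bin_gt0.
apply: (mulfI nz); rewrite mulrCA E.
have := congr1 (fun n => n%:R : C) (mul_bin_diag mu.+1 j); rewrite /= !natrM => eb.
apply: (mulIf b1); apply: (mulIf b2).
rewrite -!mulrA [_^-1 * _]mulrA mulVf// mul1r [X in _ = _ * (_ * X)]mulrCA mulVf// mulr1.
by rewrite [RHS]mulrCA eb; ring.
Qed.

End moment_values.

(** * Integrals of f against bounded multipliers *)

Section toeplitz.
Variables (R : realType) (f : R[i] -> R[i]).
Hypothesis fL2 : L2_iota f.
Local Notation C := R[i].
Local Notation Re := complex.Re.
Local Notation Im := complex.Im.
Implicit Types (p : R * R) (b c : R * R -> C) (h : {poly C}).

Lemma pi_neq0 : (pi : R) != 0.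
Proof. by rewrite gt_eqF// pi_gt0. Qed.

(** The multipliers for which f b is integrable against d iota for every f in L^2; all kernels below
    are of this kind. *)
Definition bdd b := Cmeasurable b /\ exists K : R, forall p, sqn (b p) <= K.

Lemma bdd_cst (a : C) : bdd (fun=> a).
Proof. by split; [exact: Cmeasurable_cst|exists (sqn a)]. Qed.

Lemma bddD b c : bdd b -> bdd c -> bdd (fun p => b p + c p).
Proof.
move=> [mb [K bK]] [mc [L cL]]; split; first exact: CmeasurableD.
(* From |b+c|^2 <= 2|b|^2 + 2|c|^2. *)
exists (2 * K + 2 * L) => p; have := bK p; have := cL p.
rewrite /sqn ReD ImD.
have := sqr_ge0 (Re (b p) - Re (c p)); have := sqr_ge0 (Im (b p) - Im (c p)); nra.
Qed.

Lemma bddM b c : bdd b -> bdd c -> bdd (fun p => b p * c p).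
Proof.
move=> [mb [K bK]] [mc [L cL]]; split; first exact: CmeasurableM.
by exists (K * L) => p; rewrite sqnM ler_pM ?sqn_ge0.
Qed.

Lemma bddX b n : bdd b -> bdd (fun p => b p ^+ n).
Proof.
move=> bb; elim: n => [|n IH]; first by under eq_fun do rewrite expr0; exact: bdd_cst.
by under eq_fun do rewrite exprS; exact: bddM.
Qed.

Lemma bdd_sum (I : Type) (r : seq I) (G : I -> R * R -> C) :
  (forall i, bdd (G i)) -> bdd (fun p => \sum_(i <- r) G i p).
Proof.
move=> bG; elim: r => [|i r IH].
  by under eq_fun do rewrite big_nil; exact: bdd_cst.
by under eq_fun do rewrite big_cons; exact: bddD.
Qed.

Lemma bdd_mono i j n : (i + j <= n.*2)%N -> bdd (mono i j n).
Proof.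
move=> h; split; first exact: Cmeasurable_mono.
exists 1 => p; have := @mono_le R i j n 0 p; rewrite expr0 expr1n addn0; exact.
Qed.

(* The integral of [f * b] against d iota. *)
Definition Phi b : C :=
  (pi^-1)%:C * Cintegral (fun p => f (cplx p) * b p * (gdec p ^+ 2)%:C).

Lemma iota_densE tau p :
  iota_dens tau (cplx p) = tau.+1%:R * (pi^-1 * (gdec p ^+ tau * gdec p ^+ 2)).
Proof. by rewrite /iota_dens /gdec -exprD addn2 invfM exprVn. Qed.

Lemma Cmeasurable_f : Cmeasurable (fun p => f (cplx p)).
Proof. by have [m1 [m2 _]] := fL2; split. Qed.

Lemma integrable_sqn_f :
  (@leb2 R).-integrable setT (fun p => (sqn (f (cplx p)) * gdec p ^+ 2)%:E).
Proof.
have [m1 [m2 fin]] := fL2.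
have i0 : (@leb2 R).-integrable setT
    (fun p => (sqn (f (cplx p)) * iota_dens 0 (cplx p))%:E).
  apply/integrableP; split.
    apply/measurable_EFinP; apply: measurable_funM.
      by apply: measurable_funD; exact: measurable_funX.
    under eq_fun do rewrite iota_densE expr0 !mul1r.
    apply: measurable_funM => //.
    by apply: measurable_funX; exact: measurable_gdec.
  apply: le_lt_trans fin; rewrite le_eqVlt; apply/orP; left; apply/eqP.
  apply: eq_integral => p _; rewrite gee0_abs// lee_fin mulr_ge0 ?sqn_ge0//.
  have g0 := ltW (gdec_gt0 p).
  by rewrite iota_densE expr0 !mul1r mulr_ge0 ?sqr_ge0// invr_ge0 pi_ge0.
have := integrableZl measurableT (pi : R) i0.
congr (_.-integrable _ _); apply/funext => p.
rewrite -EFinM iota_densE expr0 !mul1r; congr EFin.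
by rewrite mulrCA mulVKf// pi_neq0.
Qed.

Lemma Cintegrable_Phi b : bdd b ->
  Cintegrable (fun p => f (cplx p) * b p * (gdec p ^+ 2)%:C).
Proof.
move=> [mb [K bK]].
have K0 : 0 <= K by apply: le_trans (bK (0, 0)); exact: sqn_ge0.
(* This majorant (1+K)(1+|f|^2) is integrable because d iota is finite and f is in L^2. It works
   since K <= (1+K)^2 and |f|^2 <= (1+|f|^2)^2. *)
pose w p := (1 + K) * (gdec p ^+ 2 + sqn (f (cplx p)) * gdec p ^+ 2).
apply: (@le_Cintegrable _ _ w).
- apply: CmeasurableM; first by apply: CmeasurableM => //; exact: Cmeasurable_f.
  by apply: Cmeasurable_real; apply: measurable_funX; exact: measurable_gdec.
- have i12 := integrableD measurableT (integrable_gdec2 R) integrable_sqn_f.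
  exact: (integrableZl measurableT (1 + K) i12).
- move=> p; rewrite !sqnM sqn_real.
  have -> : w p = (1 + K) * (1 + sqn (f (cplx p))) * gdec p ^+ 2 by rewrite /w; ring.
  rewrite [leRHS]exprMn.
  apply: ler_wpM2r; first exact: sqr_ge0.
  rewrite exprMn mulrC; apply: ler_pM; rewrite ?sqn_ge0//.
    by apply: le_trans (bK p) _; nra.
  by have := sqn_ge0 (f (cplx p)); nra.
Qed.

Lemma PhiZ a b : bdd b -> Phi (fun p => a * b p) = a * Phi b.
Proof.
move=> /Cintegrable_Phi ib; rewrite /Phi [RHS]mulrCA -(CintegralZ a ib).
by congr (_ * Cintegral _); apply/funext => p; ring.
Qed.

Lemma Phi_sum (I : Type) (r : seq I) (a : I -> C) (G : I -> R * R -> C) :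
  (forall i, bdd (G i)) ->
  Phi (fun p => \sum_(i <- r) a i * G i p) = \sum_(i <- r) a i * Phi (G i).
Proof.
move=> bG; under [RHS]eq_bigr do rewrite -PhiZ//.
rewrite /Phi -mulr_sumr -Cintegral_sum.
  by congr (_ * Cintegral _); apply/funext => p; rewrite mulr_sumr mulr_suml.
by move=> i; apply: Cintegrable_Phi; apply: bddM => //; exact: bdd_cst.
Qed.

Lemma CintE tau (g : C -> C) :
  Cint tau g = Cintegral (fun p => g (cplx p) * (iota_dens tau (cplx p))%:C).
Proof.
by congr Complex; congr Rintegral; apply/funext => p;
  rewrite ?ReM ?ImM /= mulr0 ?subr0 ?add0r.
Qed.

(** The bridge from [Cint] to [Phi]: the factor mu+1 of the density cancels, and its [gdec p ^+ mu]
    is absorbed into b. *)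
Lemma Cint_Phi mu (g : C -> C) b : bdd b ->
  (forall p, g (cplx p) * (gdec p ^+ mu)%:C = f (cplx p) * b p) ->
  mu.+1%:R^-1 * Cint mu g = Phi b.
Proof.
move=> bb gb; have ib := Cintegrable_Phi bb.
rewrite CintE.
transitivity (mu.+1%:R^-1 * Cintegral (fun p =>
    (mu.+1%:R * (pi^-1)%:C) * (f (cplx p) * b p * (gdec p ^+ 2)%:C))).
  congr (_ * Cintegral _); apply/funext => p.
  by rewrite -gb iota_densE !rmorphM /= rmorph_nat; ring.
by rewrite CintegralZ// -mulrA mulKf// pnatr_eq0.
Qed.

(** * The operator [Rstar] on polynomials of degree at most mu *)

Section degree.
Variable mu : nat.

(** The total degree in z and zbar is at most 2 mu, which the factor [gdec p ^+ mu] balances. *)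
Lemma bdd_poly h j : (size h <= mu.+1)%N -> (j <= mu)%N ->
  bdd (fun p => h.[cplx p] * (cplx p)^* ^+ j * (gdec p ^+ mu)%:C).
Proof.
move=> sh jm.
have -> : (fun p => h.[cplx p] * (cplx p)^* ^+ j * (gdec p ^+ mu)%:C) =
    (fun p => \sum_(i < mu.+1) h`_i * mono i j mu p).
  apply/funext => p; rewrite (horner_coef_wide _ sh) !mulr_suml.
  by apply: eq_bigr => i _; rewrite /mono; ring.
apply: bdd_sum => i; apply: bddM; first exact: bdd_cst.
by apply: bdd_mono; have := ltn_ord i; lia.
Qed.

(** The binomial expansion of (1 + x zbar)^mu separates x from z, which exhibits the result as a
    polynomial in x. *)
Lemma RstarE h x : (size h <= mu.+1)%N -> Rstar mu f h x =
  \sum_(j < mu.+1) ('C(mu, j)%:R *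
    Phi (fun p => h.[cplx p] * (cplx p)^* ^+ j * (gdec p ^+ mu)%:C)) * x ^+ j.
Proof.
move=> sh; have bh (j : 'I_mu.+1) := bdd_poly sh (ltn_ord j : (j <= mu)%N).
pose G (j : 'I_mu.+1) p := h.[cplx p] * (cplx p)^* ^+ j * (gdec p ^+ mu)%:C.
transitivity (Phi (fun p => \sum_(j < mu.+1) ('C(mu, j)%:R * x ^+ j) * G j p)).
  apply: Cint_Phi.
    by apply: bdd_sum => j; apply: bddM; [exact: bdd_cst|exact: bh].
  move=> p; rewrite exprDn -!mulrA; congr (_ * _).
  rewrite mulr_suml mulr_sumr; apply: eq_bigr => j _.
  by rewrite expr1n mul1r exprMn /G -mulr_natl; ring.
rewrite Phi_sum; last exact: bh.
by apply: eq_bigr => j _; rewrite mulrAC.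
Qed.

Lemma mono_densE i j p : cplx p ^+ i * (cplx p)^* ^+ j * (iota_dens mu (cplx p))%:C =
  mu.+1%:R * (pi^-1)%:C * mono i j mu.+2 p.
Proof.
rewrite /mono iota_densE -exprD addn2 !rmorphM /= rmorph_nat.
by ring.
Qed.

Lemma Cintegrable_monomial i j : (i <= mu)%N -> (j <= mu)%N ->
  Cintegrable (fun p => cplx p ^+ i * (cplx p)^* ^+ j * (iota_dens mu (cplx p))%:C).
Proof.
move=> im jm; under eq_fun do rewrite mono_densE.
by apply: CintegrableZ; apply: Cintegrable_mono; lia.
Qed.

Lemma Cintegral_monomial i j : (i <= mu)%N -> (j <= mu)%N ->
  Cintegral (fun p => cplx p ^+ i * (cplx p)^* ^+ j * (iota_dens mu (cplx p))%:C) =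
  (if i == j then ('C(mu, i)%:R)^-1 else 0 : C).
Proof.
move=> im jm; under eq_fun do rewrite mono_densE.
rewrite CintegralZ; last by apply: Cintegrable_mono; lia.
rewrite mulrAC (momentE R im jm) mulrAC -rmorphM mulfV ?rmorph1 ?mul1r//.
exact: pi_neq0.
Qed.

(** Only diagonal terms survive orthogonality. The squared norms 1/C(mu,j) later cancel the
    binomials of [RstarE]. *)
Lemma inner_poly (a : 'I_mu.+1 -> C) h : (size h <= mu.+1)%N ->
  inner_mu mu (fun x => \sum_(j < mu.+1) a j * x ^+ j) (fun z => h.[z]) =
  \sum_(j < mu.+1) a j * (h`_j)^* / 'C(mu, j)%:R.
Proof.
move=> sh; rewrite /inner_mu CintE.
have im (i j : 'I_mu.+1) :=
  Cintegrable_monomial (ltn_ord i : (i <= mu)%N) (ltn_ord j : (j <= mu)%N).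
have iE (i j : 'I_mu.+1) :=
  Cintegral_monomial (ltn_ord i : (i <= mu)%N) (ltn_ord j : (j <= mu)%N).
transitivity (Cintegral (fun p => \sum_(j < mu.+1) \sum_(i < mu.+1)
    (a j * (h`_i)^*) *
    (cplx p ^+ j * (cplx p)^* ^+ i * (iota_dens mu (cplx p))%:C))).
  congr Cintegral; apply/funext => p.
  rewrite (horner_coef_wide _ sh) rmorph_sum /= !mulr_suml; apply: eq_bigr => j _.
  rewrite mulr_sumr mulr_suml; apply: eq_bigr => i _.
  by rewrite rmorphM !rmorphXn /=; ring.
rewrite Cintegral_sum; last first.
  by move=> j; apply: Cintegrable_sum => i; apply: CintegrableZ; exact: im.
apply: eq_bigr => j _; rewrite Cintegral_sum; last first.
  by move=> i; apply: CintegrableZ; exact: im.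
have E (i : 'I_mu.+1) := CintegralZ (a j * (h`_i)^*) (im j i).
under eq_bigr do rewrite E iE.
rewrite (bigD1 j)//= eqxx big1 ?addr0// => i ij.
by rewrite eq_sym (negbTE ij : (i == j :> nat) = false) mulr0.
Qed.

(* Since [(1 + x zbar)^mu] reproduces polynomials of degree at most [mu], [Rstar] is the
   compression to [H_mu] of the multiplication by [f / (mu + 1)]. *)
Lemma inner_Rstar h : (size h <= mu.+1)%N ->
  inner_mu mu (Rstar mu f h) (fun z => h.[z]) =
  Phi (fun p => h.[cplx p] * (h.[cplx p])^* * (gdec p ^+ mu)%:C).
Proof.
move=> sh; rewrite (_ : Rstar mu f h = fun x => \sum_(j < mu.+1) ('C(mu, j)%:R *
    Phi (fun p => h.[cplx p] * (cplx p)^* ^+ j * (gdec p ^+ mu)%:C)) * x ^+ j); last first.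
  by apply/funext => x; exact: RstarE.
rewrite inner_poly//.
have bh (j : 'I_mu.+1) := bdd_poly sh (ltn_ord j : (j <= mu)%N).
transitivity (\sum_(j < mu.+1) (h`_j)^* *
    Phi (fun p => h.[cplx p] * (cplx p)^* ^+ j * (gdec p ^+ mu)%:C)).
  apply: eq_bigr => j _.
  have nz : ('C(mu, j)%:R : C) != 0 by rewrite pnatr_eq0 -lt0n bin_gt0 -ltnS.
  by apply: (mulIf nz); rewrite mulfVK// mulrC mulrA mulrAC.
rewrite -Phi_sum; last exact: bh.
congr Phi; apply/funext => p.
rewrite [X in _ = _ * X^* * _](horner_coef_wide _ sh) rmorph_sum mulr_sumr mulr_suml /=.
by apply: eq_bigr => j _; rewrite rmorphM !rmorphXn /=; ring.
Qed.

(** The diagonal entries integrate f against |z|^(2j)/(1+|z|^2)^mu, and these weights, multiplied by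
    C(mu,j), add up to 1. *)
Lemma Rstar_traceE : Rstar_trace mu f = Phi (fun=> 1).
Proof.
rewrite /Rstar_trace.
have sX (j : 'I_mu.+1) : (size ('X^j : {poly C}) <= mu.+1)%N by rewrite size_polyXn.
have E (j : 'I_mu.+1) : inner_mu mu (Rstar mu f 'X^j) (fun z => z ^+ j) =
    Phi (mono j j mu).
  transitivity (inner_mu mu (Rstar mu f 'X^j) (fun z => ('X^j).[z])).
    by congr inner_mu; apply/funext => z; rewrite hornerXn.
  rewrite (inner_Rstar (sX j)); congr Phi; apply/funext => p.
  by rewrite hornerXn rmorphXn.
under eq_bigr do rewrite E.
rewrite -Phi_sum; last by move=> j; apply: bdd_mono; have := ltn_ord j; lia.
congr Phi; apply/funext => p.
transitivity (((1 + sqn (cplx p)) * gdec p)%:C ^+ mu); last first.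
  by rewrite /gdec mulfV ?expr1n// gt_eqF// one_sqn_gt0.
rewrite rmorphM exprMn rmorphD rmorph1 /= exprDn mulr_suml; apply: eq_bigr => j _.
by rewrite expr1n mul1r -mulr_natl /mono sqnE exprMn rmorphXn /=; ring.
Qed.

(** * The Berezin transform and E_{mu,k} at a fixed point z *)

Section point.
Variable z : C.

(* The kernel of the Berezin transform with exponent 1; [bker1E] shows that its complement
   to 1 is again a squared modulus. *)
Definition bker p : C :=
  (sqn (1 + z * (cplx p)^*) / ((1 + sqn z) * (1 + sqn (cplx p))))%:C.

(** Passing to the conjugate 1 + zbar s makes the factor a polynomial in s, as needed for a test
    vector in H_mu. *)
Lemma bkerE p : bker p = (1 + z^* * cplx p) * (1 + z^* * cplx p)^* *
  (((1 + sqn z)^-1)%:C * (gdec p)%:C).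
Proof.
rewrite /bker invfM !rmorphM /= sqnE !rmorphD !rmorph1 !rmorphM /= !conjCK; ring.
Qed.

Lemma bker1E p : 1 - bker p = (cplx p - z) * (cplx p - z)^* *
  (((1 + sqn z)^-1)%:C * (gdec p)%:C).
Proof.
have nz : (1 + sqn z)%:C * (1 + sqn (cplx p))%:C != 0 :> C.
  by rewrite -rmorphM -[0]/(0%:C) (inj_eq (@complexI R)) gt_eqF// mulr_gt0// one_sqn_gt0.
(* Clearing denominators leaves (1+|z|^2)(1+|s|^2) - |1 + zbar s|^2 = |s-z|^2. *)
apply: (mulIf nz); rewrite bkerE mulrBl mul1r.
have cancel (X : C) : X * (((1 + sqn z)^-1)%:C * (gdec p)%:C) *
    ((1 + sqn z)%:C * (1 + sqn (cplx p))%:C) =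
    X * (((1 + sqn z)^-1 * (1 + sqn z)) * (gdec p * (1 + sqn (cplx p))))%:C.
  by rewrite !rmorphM /=; ring.
rewrite !cancel.
rewrite /gdec !mulVf ?gt_eqF ?one_sqn_gt0// !mulr1.
have E (x : C) : (1 + sqn x)%:C = 1 + x * x^* by rewrite rmorphD rmorph1 /= sqnE.
by rewrite !E !rmorphD rmorph1 rmorphN !rmorphM /= conjCK; ring.
Qed.

Lemma bdd_bker : bdd bker.
Proof.
(* Expanding the square gives four monomials of degree at most 2 over 1+|s|^2, each bounded. *)
have -> : bker = fun p => ((1 + sqn z)^-1)%:C *
    (mono 0 0 1 p + (z * mono 0 1 1 p + (z^* * mono 1 0 1 p + z * z^* * mono 1 1 1 p))).
  apply/funext => p; rewrite bkerE /mono !expr0 !expr1.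
  by rewrite rmorphD rmorph1 rmorphM /= conjCK; ring.
apply: bddM; first exact: bdd_cst.
have bm (a : C) i j : (i + j <= 2)%N -> bdd (fun p => a * mono i j 1 p).
  by move=> ij; apply: bddM; [exact: bdd_cst|exact: bdd_mono].
by do 3 (apply: bddD; [by [exact: bdd_mono|exact: bm]|]); exact: bm.
Qed.

Lemma BerezinE tau : Berezin tau f z = Phi (fun p => bker p ^+ tau).
Proof.
(* The transform integrates against d iota_0, so the prefactor expected by [Cint_Phi] is 1^-1. *)
rewrite -[LHS]mul1r -[X in X * _]invr1.
apply: (@Cint_Phi 0); first by apply: bddX; exact: bdd_bker.
by move=> p; rewrite expr0 rmorph1 mulr1 mulrC /bker -rmorphXn /= expr_div_n exprMn.
Qed.

Lemma bdd_bker_pow k : bdd (fun p => bker p ^+ (mu - k) * (1 - bker p) ^+ k).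
Proof.
apply: bddM; apply: bddX; first exact: bdd_bker.
apply: bddD; first exact: bdd_cst.
have -> : (fun p => - bker p) = (fun p => -1 * bker p) by apply/funext => p; rewrite mulN1r.
by apply: bddM; [exact: bdd_cst|exact: bdd_bker].
Qed.

Lemma EmkE k : (k <= mu)%N -> Emk mu k f z =
  'C(mu, k)%:R * Phi (fun p => bker p ^+ (mu - k) * (1 - bker p) ^+ k).
Proof.
move=> km; rewrite /Emk; congr (_ * _).
under eq_bigr do rewrite BerezinE.
rewrite -Phi_sum; last by move=> l; apply: bddX; exact: bdd_bker.
congr Phi; apply/funext => p.
rewrite [1 - _]addrC exprDn mulr_sumr; apply: eq_bigr => l _.
have lk : (l <= k)%N by rewrite -ltnS.
(* This splits off the common power of [bker]; the remaining exponent k-l is that of the sign in the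
   expansion of (1-u)^k. *)
have -> : (mu - l = (mu - k) + (k - l))%N by lia.
rewrite expr1n mulr1 (exprNn (bker p)) exprD -mulr_natl.
by move: ((-1) ^+ (k - l)) => e; ring.
Qed.

(** The weights C(mu,k) u^(mu-k) (1-u)^k form a binomial distribution, with sum (u + (1-u))^mu =
    1. *)
Lemma sum_Emk : \sum_(k < mu.+1) Emk mu k f z = Rstar_trace mu f.
Proof.
rewrite Rstar_traceE.
rewrite (eq_bigr _ (fun (k : 'I_mu.+1) _ => EmkE (ltn_ord k : (k <= mu)%N))).
rewrite -Phi_sum; last by move=> k; exact: bdd_bker_pow.
congr Phi; apply/funext => p.
rewrite -[RHS](expr1n _ mu) -[X in X ^+ mu](subrKC (bker p) 1) exprDn.
by apply: eq_bigr => k _; rewrite mulr_natl.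
Qed.

Lemma Emk_ge0 k : (k <= mu)%N -> Rstar_psd mu f -> 0 <= Emk mu k f z.
Proof.
move=> km psd; rewrite (EmkE km).
pose q : {poly C} := 1 + z^* *: 'X.
(* Only an inequality, as q is constant when z = 0. *)
have sq : (size q <= 2)%N.
  rewrite (leq_trans (size_polyD _ _))// geq_max size_poly1 /=.
  by rewrite (leq_trans (size_scale_leq _ _))// size_polyX.
pose h : {poly C} := q ^+ (mu - k) * ('X - z%:P) ^+ k.
have sh : (size h <= mu.+1)%N.
  apply: leq_trans (size_polyMleq _ _) _.
  rewrite size_exp_XsubC addnS /=.
  have sqX : (size (q ^+ (mu - k)) <= (mu - k).+1)%N.
    apply: leq_trans (size_poly_exp_leq _ _) _.
    by rewrite ltnS -[leqRHS]mul1n leq_mul2r -subn1 leq_subLR sq orbT.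
  by apply: leq_trans (leq_add sqX (leqnn k)) _; rewrite addSn subnK.
have := psd h sh; rewrite inner_Rstar// => h0.
have bh : bdd (fun p => h.[cplx p] * (h.[cplx p])^* * (gdec p ^+ mu)%:C).
  have -> : (fun p => h.[cplx p] * (h.[cplx p])^* * (gdec p ^+ mu)%:C) =
     (* Expanding only the conjugate factor produces the products covered by [bdd_poly]. *)
     (fun p => \sum_(j < mu.+1) (h`_j)^* *
       (h.[cplx p] * (cplx p)^* ^+ j * (gdec p ^+ mu)%:C)).
    apply/funext => p.
    rewrite [X in _ * X^* * _](horner_coef_wide _ sh) rmorph_sum mulr_sumr mulr_suml /=.
    by apply: eq_bigr => j _; rewrite rmorphM !rmorphXn /=; ring.
  by apply: bdd_sum => j; apply: bddM; [exact: bdd_cst|apply: bdd_poly => //; rewrite -ltnS].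
(* Each of the mu factors u or 1-u contributes one (1+|z|^2)^-1, a nonnegative constant that leaves
   the integral. *)
have -> : (fun p => bker p ^+ (mu - k) * (1 - bker p) ^+ k) =
   (fun p => (((1 + sqn z)^-1) ^+ mu)%:C *
     (h.[cplx p] * (h.[cplx p])^* * (gdec p ^+ mu)%:C)).
  apply/funext => p; rewrite bker1E bkerE !exprMn.
  have -> : h.[cplx p] = (1 + z^* * cplx p) ^+ (mu - k) * (cplx p - z) ^+ k.
    by rewrite /h /q hornerM !horner_exp !hornerE.
  rewrite rmorphM !rmorphXn /=.
  have split_mu (x : C) : x ^+ mu = x ^+ (mu - k) * x ^+ k by rewrite -exprD subnK.
  rewrite (split_mu (gdec p)%:C) (split_mu ((1 + sqn z)^-1)%:C).
  ring.
rewrite PhiZ// mulr_ge0// mulr_ge0//.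
by rewrite ler0c exprn_ge0// invr_ge0 ltW// one_sqn_gt0.
Qed.

End point.
End degree.
End toeplitz.

Theorem mainTheorem4 (R : realType) (mu k : nat) (f : R[i] -> R[i]) :
  (k <= mu)%N -> L2_iota f -> Rstar_psd mu f ->
  forall z : R[i], 0 <= Emk mu k f z /\ Emk mu k f z <= Rstar_trace mu f.
Proof.
move=> km fL2 psd z; split; first exact: Emk_ge0.
rewrite -(sum_Emk fL2 mu z) (bigD1 (Ordinal (km : (k < mu.+1)%N)))//= lerDl.
by apply: sumr_ge0 => i _; apply: Emk_ge0 => //; rewrite -ltnS.
Qed.
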